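(* Suppose that $\kappa\ge\mathfrak d$ is a regular uncountable cardinal that is not weakly compact. Then $\mathrm{onto}^+(\mathcal J^\kappa_\kappa,\omega)$ holds.
   Context: $\mathfrak d$ is the dominating number, i.e., the least size of a cofinal family in $({}^\omega\omega,<^* )$, where $f<^*g$ means $f(n)<g(n)$ for all but finitely many $n$. An ideal over $\kappa$ is a nonempty family $J$ of subsets of $\kappa$ closed under subsets and finite unions; it is $\kappa$-complete if it is closed under unions of fewer than $\kappa$ of its members; $J^+:=\mathcal P(\kappa)\setminus J$. $\mathcal J^\kappa_\kappa$ is the collection of all $\kappa$-complete ideals over $\kappa$ containing all bounded subsets of $\kappa$. $[\kappa]^2$ is identified with the set of pairs $(\alpha,\beta)$ with $\alpha<\beta<\kappa$. $\mathrm{onto}^+(\mathcal J^\kappa_\kappa,\omega)$ asserts that there is a colouring $c:[\kappa]^2\to\omega$ such that for every $J\in\mathcal J^\kappa_\kappa$ and every $B\in J^+$ there is $\eta<\kappa$ such that for every $n<\omega$, $\{\beta\in B\setminus(\eta+1)\mid c(\eta,\beta)=n\}\in J^+$. *)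

(* Defs.v *)
From mathcomp Require Import all_boot all_order.
From mathcomp Require Import boolp classical_sets functions cardinality wochoice.

Set Implicit Arguments.
Unset Strict Implicit.
Unset Printing Implicit Defensive.

Local Open Scope classical_set_scope.
Local Open Scope card_scope.
Local Open Scope order_scope.

Definition card_lt (T U : Type) (A : set T) (B : set U) : Prop := ~ (B #<= A).

Definition eventually_lt (f g : nat -> nat) : Prop :=
  finite_set [set n | ~ (f n < g n)%N].

Definition dominating_family (D : set (nat -> nat)) : Prop :=
  forall f : nat -> nat, exists2 g, D g & eventually_lt f g.

(* There is no type of cardinals: the dominating number is represented by any
   dominating family of least size. *)
Definition has_dominating_number (D : set (nat -> nat)) : Prop :=
  dominating_family D /\
  forall E : set (nat -> nat), dominating_family E -> D #<= E.

(* A cardinal kappa is a linear order K isomorphic to an initial ordinal; the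
   elements of K are the ordinals below kappa. *)
Definition is_cardinal (disp : Order.disp_t) (K : orderType disp) : Prop :=
  well_order (<=%O : rel K) /\
  forall a : K, card_lt [set x : K | x < a] [set: K].

Definition bounded_subset (disp : Order.disp_t) (K : orderType disp)
  (A : set K) : Prop := exists a : K, A `<=` [set x | x < a].

Definition regular_cardinal (disp : Order.disp_t) (K : orderType disp) : Prop :=
  [/\ is_cardinal K, infinite_set [set: K] &
      forall A : set K, ~ bounded_subset A -> [set: K] #<= A].

(* kappa is uncountable and satisfies kappa -> (kappa)^2_2; only the values
   c a b with a < b are relevant. *)
Definition weakly_compact (disp : Order.disp_t) (K : orderType disp) : Prop :=
  [/\ is_cardinal K, ~ countable [set: K] &
      forall c : K -> K -> bool, exists H : set K, exists i : bool,
        H #= [set: K] /\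
        forall a b : K, H a -> H b -> a < b -> c a b = i].

Definition is_ideal (T : Type) (J : set (set T)) : Prop :=
  [/\ J !=set0,
      forall A B : set T, A `<=` B -> J B -> J A &
      forall A B : set T, J A -> J B -> J (A `|` B)].

Definition complete_ideal (T : Type) (J : set (set T)) : Prop :=
  forall F : set (set T), F `<=` J -> card_lt F [set: T] ->
    J (\bigcup_(A in F) A).

(* The ideals are not required to be proper. *)
Definition complete_ideals (disp : Order.disp_t) (K : orderType disp) :
    set (set (set K)) :=
  [set J | [/\ is_ideal J, complete_ideal J &
               forall A : set K, bounded_subset A -> J A]].
Arguments complete_ideals {disp} K.

Definition positive (T : Type) (J : set (set T)) : set (set T) := ~` J.

(* onto^+(Js, omega); a colouring of [kappa]^2 is a binary function of which
   only the values c a b with a < b are used. *)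
Definition onto_plus_omega (disp : Order.disp_t) (K : orderType disp)
    (Js : set (set (set K))) : Prop :=
  exists c : K -> K -> nat,
    forall J : set (set K), Js J -> forall B : set K, positive J B ->
      exists eta : K, forall n : nat,
        positive J [set beta | [/\ B beta, eta < beta & c eta beta = n]].

(* Main.v *)
(* Assign to every b < kappa a subset r b of kappa, so that for each positive B
   some a has both {b in B | a in r b} and {b in B | a notin r b} positive and
   2^|a| < kappa.  If kappa is not a strong limit, take r injective into the
   subsets of the least theta with 2^theta >= kappa; otherwise let
   r b = {a | c a b} for a 2-colouring c witnessing that kappa is not weakly
   compact: a B that is never split would yield a homogeneous set of size kappa.

   For eta in B let S_B(eta) be the set of those g such that positively many
   b in B have r b first differing from r eta at g.  Some S_B(eta) is infinite.
   Otherwise, by sigma-completeness, a positive B has all |S_B(eta)| <= n; since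
   fewer than kappa nodes lie below a, B contains two positive nodes branching
   at a common g, and passing to one of them decreases all the sets S_B(eta).

   Ladders at the points delta of cofinality omega map every infinite subset of
   kappa onto an infinite subset of omega, and a dominating family gives interval
   partitions of omega such that each infinite set meets almost all blocks of one
   of them; labelling the blocks makes every label appear.  The row a of the
   colouring encodes eta, delta and a member of the dominating family, which is
   possible because kappa * kappa = kappa >= d. *)
Require Import Defs.
From Stdlib Require Import Wellfounded Relation_Operators.
From mathcomp Require Import all_boot all_order.
From mathcomp Require Import boolp classical_sets functions cardinality wochoice.

Import Order.TTheory.

Local Open Scope classical_set_scope.
Local Open Scope card_scope.
Local Open Scope order_scope.

(** * Comparing cardinalities by relations and by recursion *)

(** [R] is the graph of a partial surjection from [B] onto [A], so no default element of either type
    has to be chosen. *)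
Lemma card_le_relP (T U : Type) (A : set T) (B : set U) :
  A #<= B <-> exists R : U -> T -> Prop,
    (forall y x x', R y x -> R y x' -> x = x') /\
    (forall x, A x -> exists2 y, B y & R y x).
Proof.
split=> [/ocard_geP[g]|[R [Rfun RA]]].
  exists (fun y x => g y = Some x); split=> [y x x' -> []//|x Ax].
  by have [y By gy] := @surj _ _ _ _ g (Some x) (ex_intro2 _ _ x Ax erefl); exists y.
have /choice[g gP] : forall y, exists o : option T, forall x, R y x -> o = Some x.
  move=> y; have [[x Ryx]|noR] := pselect (exists x, R y x).
    by exists (Some x) => x' Ryx'; rewrite (Rfun _ _ _ Ryx Ryx').
  by exists None => x Ryx; case: noR; exists x.
apply/ocard_geP; rewrite surjPex; exists g => _ [x Ax <-].
by have [y By Ryx] := RA _ Ax; exists y => //; exact: gP.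
Qed.

Lemma inj_on_card_le (T U : Type) (f : T -> U) (A : set T) (B : set U) :
  (forall x, A x -> B (f x)) ->
  (forall x y, A x -> A y -> f x = f y -> x = y) -> A #<= B.
Proof.
move=> fAB finj; apply/card_le_relP.
exists (fun y x => A x /\ f x = y); split; last by move=> x Ax; exists (f x); auto.
by move=> y x x' [Ax fx] [Ax' fx']; apply: finj => //; rewrite fx.
Qed.

Lemma card_leX2 (T U : Type) (A : set T) (B : set U) :
  A #<= B -> A `*` A #<= B `*` B.
Proof.
move=> /card_le_relP[R [Rfun RA]]; apply/card_le_relP.
exists (fun q p => R q.1 p.1 /\ R q.2 p.2); split.
  move=> q [x1 x2] [x1' x2'] /= [R1 R2] [R1' R2'].
  by rewrite (Rfun _ _ _ R1 R1') (Rfun _ _ _ R2 R2').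
move=> [x1 x2] /= [/RA[y1 By1 R1] /RA[y2 By2 R2]].
by exists (y1, y2).
Qed.

Lemma infinite_set_seq (T : Type) (A : set T) : infinite_set A ->
  exists2 e : nat -> T, injective e & forall n, A (e n).
Proof.
move=> /infiniteP/card_le_relP[R [Rfun RA]].
have /choice[e eP] n : exists y, A y /\ R y n.
  by have [y] := RA n I; exists y.
exists e => [n m enm|n]; last by have [] := eP n.
by apply: (Rfun (e n)); [have [] := eP n | rewrite enm; have [] := eP m].
Qed.

(** Hilbert's hotel along a sequence in [A]: [a] is sent to [e 0], and each [e n] moves to
    [e n.+1]. *)
Lemma card_le_infinite_setU1 (T : Type) (a : T) (A : set T) :
  infinite_set A -> a |` A #<= A.
Proof.
move=> /infinite_set_seq[e einj eA]; apply/card_le_relP.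
exists (fun y x => [\/ y = e 0%N /\ x = a, exists2 n, y = e n.+1 & x = e n |
                  (forall n, y <> e n) /\ x = y]); split.
  move=> y x x' [[-> ->]|[n -> ->]|[ye ->]] [[]|[m]|[]].
  - by move=> _ ->.
  - by move=> /einj.
  - by move=> /(_ 0%N).
  - by move=> /einj.
  - by move=> /einj[<-].
  - by move=> /(_ n.+1).
  - by move=> /ye.
  - by move=> /ye.
  - by [].
move=> x [->|Ax]; first by exists (e 0%N); [exact: eA | constructor 1].
have [[n ->]|xe] := pselect (exists n, x = e n).
  by exists (e n.+1); [exact: eA | constructor 2; exists n].
by exists x => //; constructor 3; split=> // n xen; apply: xe; exists n.
Qed.

(** Each [x] receives a value in [B] not taken at its [R]-predecessors in [A], which are too few to
    exhaust [B]. *)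
Lemma card_le_by_recursion (T U : Type) (R : T -> T -> Prop)
  (A : set T) (B : set U) :
  well_founded R ->
  (forall x y, A x -> A y -> x <> y -> R x y \/ R y x) ->
  (forall x, A x -> ~ (B #<= [set y | A y /\ R y x])) ->
  A #<= B.
Proof.
elim/Pchoice: U => U in B *.
move=> Rwf Rtot RB.
have [->|/set0P[x0 Ax0]] := eqVneq A set0; first exact: card_ge0.
have [y0 _] : B !=set0.
  by apply: contrapT => /nonemptyPn B0; apply: (RB _ Ax0); rewrite B0 card_ge0.
pose step x (rec : forall y, R y x -> U) :=
  xget y0 [set z | B z /\ forall y (h : R y x), A y -> z <> rec y h].
pose f := Fix Rwf (fun=> U) step.
have fE x : f x = xget y0 [set z | B z /\ forall y, R y x -> A y -> z <> f y].
  rewrite /f Fix_eq // => {}x g h gh; congr step.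
  by apply/functional_extensionality_dep => y; apply: funext => yx; exact: gh.
have fP x : A x -> B (f x) /\ forall y, R y x -> A y -> f x <> f y.
  move=> Ax; pose S := [set z | B z /\ forall y, R y x -> A y -> z <> f y].
  suff : S (f x) by [].
  rewrite fE; apply: xgetPex.
  apply: contrapT => noz; apply: (RB x Ax).
  apply: card_le_trans (card_image_le f _); apply: subset_card_le => z Bz.
  apply: contrapT => zf; apply: noz; exists z; split=> // y yx Ay zfy.
  by apply: zf; exists y.
apply: (@inj_on_card_le _ _ f) => [x /fP[]//|x y Ax Ay fxy].
apply: contrapT => /(Rtot _ _ Ax Ay)[xy|yx].
  by have [_ /(_ _ xy Ax)] := fP _ Ay; apply.
by have [_ /(_ _ yx Ay)] := fP _ Ax; apply.
Qed.

(** * Well orders and the square of an infinite cardinal *)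

Lemma well_order_min (disp : Order.disp_t) (K : orderType disp) (P : K -> Prop) :
  well_order (<=%O : rel K) -> (exists x, P x) ->
  exists2 x, P x & forall y, y < x -> ~ P y.
Proof.
move=> woK [x0 Px0].
have [|x [[Px xmin] _]] := woK (fun x => `[< P x >]).
  by exists x0; apply/asboolP.
exists x => [|y yx Py]; first exact/asboolP.
by have := xmin y (asboolT Py); rewrite leNgt yx.
Qed.

Lemma well_order_wf (disp : Order.disp_t) (K : orderType disp) :
  well_order (<=%O : rel K) -> well_founded (fun x y : K => x < y).
Proof.
move=> woK x; apply: contrapT => nAx.
have [y nAy ymin] := well_order_min _ _ (fun x => ~ Acc _ x) woK (ex_intro _ x nAx).
by apply: nAy; constructor => z /ymin/contrapT.
Qed.

(* Goedel's ordering of pairs: first by maximum, then lexicographically. *)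
Lemma card_setX2_initial (disp : Order.disp_t) (K : orderType disp) (A : set K) :
  well_order (<=%O : rel K) ->
  (forall m, A m ->
     ~ (A #<= [set x : K | x <= m] `*` [set x : K | x <= m])) ->
  A `*` A #<= A.
Proof.
move=> woK Asmall; have wfK := well_order_wf _ _ woK.
pose key (p : K * K) := (Order.max p.1 p.2, p).
pose R (p q : K * K) :=
  slexprod _ _ (fun x y : K => x < y)
    (slexprod _ _ (fun x y : K => x < y) (fun x y : K => x < y)) (key p) (key q).
have Rwf : well_founded R.
  apply: (@wf_inverse_image _ _ _ key).
  by do 2?[apply: wf_slexprod].
(* The predecessors of [q] stay in the square of the closed segment ending at the larger coordinate
   of [q]. *)
have Rmax p q : R p q -> p.1 <= Order.max q.1 q.2 /\ p.2 <= Order.max q.1 q.2.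
  move=> Rpq; have : Order.max p.1 p.2 <= Order.max q.1 q.2.
    by inversion Rpq => //; exact: ltW.
  by rewrite ge_max => /andP[].
apply: (card_le_by_recursion _ _ R) => //.
- move=> p q _ _ pq; rewrite /R /key.
  have [mpq|mqp|->] := ltgtP (Order.max p.1 p.2) (Order.max q.1 q.2).
  + by left; constructor.
  + by right; constructor.
  move: p q pq => [p1 p2] [q1 q2] /= pq.
  have [pq1|qp1|e1] := ltgtP p1 q1.
  + by left; constructor 2; constructor.
  + by right; constructor 2; constructor.
  have [pq2|qp2|e2] := ltgtP p2 q2.
  + by left; rewrite e1; constructor 2; constructor 2.
  + by right; rewrite e1; constructor 2; constructor 2.
  by case: pq; rewrite e1 e2.
move=> p [Ap1 Ap2] Ale; apply: (Asmall (Order.max p.1 p.2)).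
  by case: leP.
by apply: card_le_trans Ale _; apply: subset_card_le => q [_ /Rmax].
Qed.

Lemma infinite_closed_segment (disp : Order.disp_t) (K : orderType disp) (a : K) :
  infinite_set [set x : K | x <= a] ->
  infinite_set [set x : K | x < a] /\
  [set x : K | x <= a] #<= [set x : K | x < a].
Proof.
have -> : [set x : K | x <= a] = a |` [set x : K | x < a].
  by apply/seteqP; split=> x /=; rewrite le_eqVlt => /predU1P.
move=> ainf; have Oinf : infinite_set [set x : K | x < a].
  by apply: contra_not ainf => Ofin; rewrite finite_setU; split.
by split=> //; exact: card_le_infinite_setU1.
Qed.

(** If an earlier segment is as large, induction applies to it. Otherwise the segment is larger than
    every earlier one, hence than their squares, and Goedel's ordering applies. *)
Lemma card_infinite_segmentX2 (disp : Order.disp_t) (K : orderType disp) (a : K) :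
  well_order (<=%O : rel K) -> infinite_set [set x : K | x <= a] ->
  [set x : K | x <= a] `*` [set x : K | x <= a] #<= [set x : K | x <= a].
Proof.
move=> woK; elim/(well_founded_ind (well_order_wf _ _ woK)): a => a IH ainf.
have [[b ba ab]|noab] := pselect (exists2 b, b < a &
    [set x : K | x <= a] #<= [set x : K | x <= b]).
  have binf : infinite_set [set x : K | x <= b].
    by apply: contra_not ainf; exact: card_le_finite ab.
  apply: card_le_trans (card_leX2 _ _ _ _ ab) _.
  apply: card_le_trans (IH b ba binf) _.
  by apply: subset_card_le => x /= xb; exact: le_trans xb (ltW ba).
have [Oinf CO] := infinite_closed_segment _ _ _ ainf.
apply: card_le_trans (card_leX2 _ _ _ _ CO) _.
apply: (@card_le_trans _ _ _ [set x : K | x < a]); last first.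
  by apply: subset_card_le => x /= /ltW.
apply: card_setX2_initial => // b /= ba Ob.
have [bfin|binf] := pselect (finite_set [set x : K | x <= b]).
  by apply: Oinf; apply: card_le_finite Ob _; exact: finite_setX.
apply: noab; exists b => //; apply: card_le_trans CO _.
by apply: card_le_trans Ob _; exact: IH.
Qed.

Lemma card_cardinalX2 (disp : Order.disp_t) (K : orderType disp) :
  is_cardinal K -> infinite_set [set: K] ->
  [set: K] `*` [set: K] #<= [set: K].
Proof.
move=> [woK Ksmall] Kinf; apply: card_setX2_initial => // m _ Km.
have [mfin|minf] := pselect (finite_set [set x : K | x <= m]).
  by apply: Kinf; apply: card_le_finite Km _; exact: finite_setX.
have [_ CO] := infinite_closed_segment _ _ _ minf.
apply: (Ksmall m); apply: card_le_trans Km _.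
exact: card_le_trans (card_infinite_segmentX2 _ _ _ woK minf) CO.
Qed.

(** * Positive sets of complete ideals *)

Lemma complete_ideal_bigcup (T I : Type) (J : set (set T)) (X : set I)
  (F : I -> set T) :
  complete_ideal J -> card_lt X [set: T] -> (forall i, X i -> J (F i)) ->
  J (\bigcup_(i in X) F i).
Proof.
move=> Jc Xsmall JF.
have -> : \bigcup_(i in X) F i = \bigcup_(A in F @` X) A by rewrite bigcup_image.
apply: Jc => [_ [i Xi <-]|TF]; first exact: JF.
by apply: Xsmall; exact: card_le_trans TF (card_image_le _ _).
Qed.

Lemma positive_bigcup (T I : Type) (J : set (set T)) (X : set I)
  (F : I -> set T) (B : set T) :
  is_ideal J -> complete_ideal J -> card_lt X [set: T] -> positive J B ->
  B `<=` \bigcup_(i in X) F i -> exists2 i, X i & positive J (F i).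
Proof.
move=> [_ Jsub _] Jc Xsmall PB BF; apply: contrapT => noi; apply: PB.
apply: Jsub BF _; apply: complete_ideal_bigcup => // i Xi.
by apply: contrapT => PF; apply: noi; exists i.
Qed.

Lemma positive_sub (T : Type) (J : set (set T)) (A B : set T) :
  is_ideal J -> A `<=` B -> positive J A -> positive J B.
Proof. by move=> [_ Jsub _] AB PA JB; apply: PA; exact: Jsub JB. Qed.

Lemma positive_setD (T : Type) (J : set (set T)) (A N : set T) :
  is_ideal J -> J N -> positive J A -> positive J (A `\` N).
Proof.
move=> [_ Jsub JU] JN PA JAN; apply: PA; apply: Jsub (JU _ _ JAN JN) => x Ax.
by have [Nx|Nx] := pselect (N x); [right | left].
Qed.

Lemma positive_nonempty (T : Type) (J : set (set T)) (A : set T) :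
  is_ideal J -> positive J A -> A !=set0.
Proof.
move=> [[X JX] Jsub _] PA; apply: contrapT => /nonemptyPn A0; apply: PA.
by rewrite A0; exact: Jsub JX.
Qed.

(** * Branching of positive sets in the binary tree *)

(** Subsets are read as branches of the binary tree, and [g] is the level at which two of them
    part. *)
Definition splits_at (disp : Order.disp_t) (K : orderType disp) (x y : set K)
    (g : K) : Prop :=
  (forall z, z < g -> (x z <-> y z)) /\ ~ (x g <-> y g).
Arguments splits_at {disp K}.

Lemma splits_at_inj (disp : Order.disp_t) (K : orderType disp) (x y : set K)
  (g h : K) : splits_at x y g -> splits_at x y h -> g = h.
Proof.
move=> [gE gN] [hE hN]; case: (ltgtP g h) => // [/hE|/gE]; tauto.
Qed.

Definition positive_splits (disp : Order.disp_t) (K : orderType disp)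
    (J : set (set K)) (r : K -> set K) (B : set K) (eta : K) : set K :=
  [set g | positive J [set b | B b /\ splits_at (r eta) (r b) g]].
Arguments positive_splits {disp K}.

(** The cardinality bound lets a positive set be thinned to a positive one on which all [r b] agree
    below [a]. *)
Definition small_splitting (disp : Order.disp_t) (K : orderType disp)
    (r : K -> set K) : Prop :=
  forall J B, complete_ideals K J -> positive J B ->
    exists2 a : K, card_lt [set X : set K | X `<=` [set x | x < a]] [set: K] &
      positive J [set b | B b /\ r b a] /\ positive J [set b | B b /\ ~ r b a].
Arguments small_splitting {disp K}.

Lemma positive_node (disp : Order.disp_t) (K : orderType disp)
  (J : set (set K)) (r : K -> set K) (B : set K) (a : K) :
  complete_ideals K J -> positive J B ->
  card_lt [set X : set K | X `<=` [set x | x < a]] [set: K] ->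
  exists t : set K,
    positive J [set b | B b /\ forall z, z < a -> (r b z <-> t z)].
Proof.
move=> [Ji Jc _] PB asmall.
pose F (t : set K) := [set b | B b /\ forall z, z < a -> (r b z <-> t z)].
have [|t _ Pt] := positive_bigcup _ _ _ _ F _ Ji Jc asmall PB; last by exists t.
move=> b Bb; exists (r b `&` [set x | x < a]) => [x []//|].
by split=> // z za; split=> [rz|[]//]; split.
Qed.

(** The two halves of [B] are thinned to positive nodes [N0] and [N1]. All of [N1] parts from any
    [eta] in [N0] at one level [g], while no member of [N0] does. *)
Lemma positive_splits_shrink (disp : Order.disp_t) (K : orderType disp)
  (J : set (set K)) (r : K -> set K) (B : set K) :
  well_order (<=%O : rel K) -> small_splitting r ->
  complete_ideals K J -> positive J B ->
  exists (N : set K) (g : K), [/\ positive J N, N `<=` B &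
    forall eta, N eta -> positive_splits J r B eta g /\
                      ~ positive_splits J r N eta g].
Proof.
move=> woK rsplit JK PB; have [Ji _ _] := JK.
have [a asmall [P1 P0]] := rsplit _ _ JK PB.
have [u Pu] := positive_node _ _ _ r _ _ JK P1 asmall.
have [t Pt] := positive_node _ _ _ r _ _ JK P0 asmall.
set N1 := [set b | _] in Pu; set N0 := [set b | _] in Pt.
(* The level is the first difference of [t] and [u] below [a], or [a] itself if they agree there. *)
have [g [N01 N00]] : exists g, (forall b0 b1, N0 b0 -> N1 b1 -> splits_at (r b0) (r b1) g)
    /\ (forall b b', N0 b -> N0 b' -> (r b g <-> r b' g)).
  have [[g0 [g0a g0ut]]|tu] := pselect (exists g, g < a /\ ~ (t g <-> u g)).
    have [g [ga gut] gmin] := well_order_min _ _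
      (fun g => g < a /\ ~ (t g <-> u g)) woK (ex_intro _ g0 (conj g0a g0ut)).
    exists g; split=> [b0 b1 [_ b0t] [_ b1u]|b b' [_ /(_ _ ga)bt] [_ /(_ _ ga)b't]].
      split=> [z zg|]; last by move: (b0t _ ga) (b1u _ ga); tauto.
      have za := lt_trans zg ga.
      have : t z <-> u z by apply: contrapT => tuz; exact: (gmin _ zg).
      by move: (b0t _ za) (b1u _ za); tauto.
    by tauto.
  exists a; split=> [b0 b1 [[_ nb0] b0t] [[_ b1a] b1u]|b b' [[_ nb] _] [[_ nb'] _]].
    split=> [z za|]; last by tauto.
    have : t z <-> u z by apply: contrapT => tuz; apply: tu; exists z.
    by move: (b0t _ za) (b1u _ za); tauto.
  by tauto.
exists N0, g; split=> // [b [[]]//|eta N0eta]; split.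
  apply: positive_sub Pu => // b N1b; split; first by case: N1b => -[].
  exact: N01.
move=> PN; have [b [N0b [_]]] := positive_nonempty _ _ _ Ji PN.
by apply; exact: N00.
Qed.

Lemma positive_splits_mono (disp : Order.disp_t) (K : orderType disp)
  (J : set (set K)) (r : K -> set K) (A B : set K) (eta : K) :
  is_ideal J -> A `<=` B ->
  positive_splits J r A eta `<=` positive_splits J r B eta.
Proof.
by move=> Ji AB g; apply: positive_sub => // b [/AB Bb rb].
Qed.

(* Passing to a positive node on one side of a splitting removes a common
   splitting point, so the number of positive splits could be decreased
   forever. *)
Lemma positive_splits_unbounded (disp : Order.disp_t) (K : orderType disp)
  (J : set (set K)) (r : K -> set K) (n : nat) (B : set K) :
  well_order (<=%O : rel K) -> small_splitting r ->
  complete_ideals K J -> positive J B ->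
  ~ (forall eta, B eta -> exists2 s : seq K, (size s <= n)%N &
       forall g, positive_splits J r B eta g -> g \in s).
Proof.
move=> woK rsplit JK; have [Ji _ _] := JK; elim: n B => [|n IH] B PB Bn.
all: have [N [g [PN NB Ng]]] := positive_splits_shrink _ _ _ _ _ woK rsplit JK PB.
  have [eta Neta] := positive_nonempty _ _ _ Ji PN.
  have [[|//] _ /(_ g)] := Bn _ (NB _ Neta).
  by have [Bg _] := Ng _ Neta => /(_ Bg).
apply: (IH N PN) => eta Neta; have [s ssize sP] := Bn _ (NB _ Neta).
have [Bg nNg] := Ng _ Neta.
exists (rem g s) => [|h Nh].
  by rewrite size_rem ?sP // -subn1 leq_subLR add1n.
have hs : h \in s by apply: sP; exact: positive_splits_mono Nh.
move: hs; rewrite (perm_mem (perm_to_rem (sP _ Bg))) inE => /predU1P[hg|//].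
by rewrite hg in Nh.
Qed.

Lemma infinite_positive_splits (disp : Order.disp_t) (K : orderType disp)
  (J : set (set K)) (r : K -> set K) (B : set K) :
  well_order (<=%O : rel K) -> ~ countable [set: K] -> small_splitting r ->
  complete_ideals K J -> positive J B ->
  exists eta, infinite_set (positive_splits J r B eta).
Proof.
move=> woK uncK rsplit JK PB; have [Ji Jc _] := JK.
apply: contrapT => noeta.
pose F n := [set eta | B eta /\ exists2 s : seq K, (size s <= n)%N &
       forall g, positive_splits J r B eta g -> g \in s].
(* [uncK] unfolds to [card_lt [set: nat] [set: K]], which gives completeness for countable
   unions. *)
have [|n _ Pn] := positive_bigcup _ _ _ [set: nat] F _ Ji Jc uncK PB.
  move=> eta Beta.
  have : finite_set (positive_splits J r B eta).
    by apply: contrapT => inf; apply: noeta; exists eta.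
  by move=> /finite_seqP[s sE]; exists (size s) => //; split=> //; exists s; rewrite ?sE.
apply: (positive_splits_unbounded _ _ _ _ n _ woK rsplit JK Pn).
move=> eta [Beta [s ssize sP]]; exists s => // g gF; apply: sP.
by apply: positive_splits_mono gF => // ? [].
Qed.

(** * Existence of a splitting assignment *)

Lemma regular_no_max (disp : Order.disp_t) (K : orderType disp) (a : K) :
  regular_cardinal K -> exists b : K, a < b.
Proof.
move=> [_ Kinf Kreg]; apply: contrapT => noa; apply: Kinf.
apply: (@card_le_finite _ _ _ [set a]); last exact: finite_set1.
apply: Kreg => -[b /(_ a erefl) /= ab]; apply: noa; by exists b.
Qed.

Lemma bounded_upper (disp : Order.disp_t) (K : orderType disp) (a : K) :
  regular_cardinal K -> bounded_subset [set x : K | x <= a].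
Proof.
move=> /(regular_no_max _ _ a)[b ab]; exists b => x /= xa.
exact: le_lt_trans xa ab.
Qed.

(** For the least such [a], every [d < a] satisfies the cardinality bound. If none splits [B],
    almost all [b] in [B] share one trace below [a], and injectivity of [r] leaves at most one
    [b]. *)
Lemma small_splitting_not_strong_limit (disp : Order.disp_t) (K : orderType disp) :
  regular_cardinal K ->
  (exists a : K, [set: K] #<= [set X : set K | X `<=` [set x | x < a]]) ->
  exists r : K -> set K, small_splitting r.
Proof.
move=> regK exa; have [[woK Ksmall] _ _] := regK.
have [a /card_le_relP[R [Rfun RK]] amin] := well_order_min _ _ _ woK exa.
have /choice[r rP] b : exists X : set K, X `<=` [set x | x < a] /\ R X b.
  by have [X] := RK b I; exists X.
exists r => J B JK PB; have [Ji Jc Jb] := JK.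
apply: contrapT => nosplit.
have dec d : d < a -> J [set b | B b /\ r b d] \/ J [set b | B b /\ ~ r b d].
  move=> da; apply: contrapT => /not_orP[P1 P0].
  by apply: nosplit; exists d => //; exact: amin.
(* The trace shared by almost all [b] in [B]. *)
pose x := [set d | J [set b | B b /\ ~ r b d]].
pose N d := [set b | B b /\ ~ (r b d <-> x d)].
have JN d : d < a -> J (N d).
  move=> /dec JB; have [_ Jsub _] := Ji.
  have [xd|nxd] := pselect (x d); first by apply: Jsub (xd) => b [? ?] /=; tauto.
  by case: JB => // JB; apply: Jsub JB => b [? ?] /=; split=> //; apply: contrapT; tauto.
have PD : positive J (B `\` \bigcup_(d in [set d | d < a]) N d).
  by apply: positive_setD => //; exact: complete_ideal_bigcup.
have rx b : (B `\` \bigcup_(d in [set d | d < a]) N d) b ->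
    r b = x `&` [set d | d < a].
  move=> [Bb nb]; have [ra _] := rP b.
  apply/seteqP; split=> d; last first.
    move=> [xd da]; apply: contrapT => nrd.
    by apply: nb; exists d => //; split=> //; tauto.
  move=> rd; have da : d < a by exact: ra.
  split=> //; apply: contrapT => nxd.
  by apply: nb; exists d => //; split=> //; tauto.
have [b0 b0P] := positive_nonempty _ _ _ Ji PD.
apply: PD; have [_ Jsub _] := Ji.
apply: (Jsub _ [set z | z <= b0]); last by apply: Jb; exact: bounded_upper.
move=> b bP; have [_ Rb] := rP b; have [_ Rb0] := rP b0.
rewrite (rx _ bP) -(rx _ b0P) in Rb.
by rewrite (Rfun _ _ _ Rb Rb0) /=.
Qed.

(** Zorn gives a maximal homogeneous [H] inside [B]. Were it smaller than kappa, completeness would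
    leave a point of [B] above [H] having colour [i] with all its members, and [H] could be
    extended. *)
Lemma homogeneous_set (disp : Order.disp_t) (K : orderType disp)
  (J : set (set K)) (c : K -> K -> bool) (i : bool) (B : set K) :
  regular_cardinal K -> complete_ideals K J -> positive J B ->
  (forall a, B a -> J [set b | B b /\ c a b != i]) ->
  exists2 H : set K, H #= [set: K] &
    forall a b : K, H a -> H b -> a < b -> c a b = i.
Proof.
move=> regK [Ji Jc Jb] PB JB.
pose P (H : set K) := H `<=` B /\ forall a b : K, H a -> H b -> a < b -> c a b = i.
have [|H [[HB Hi] Hmax]] := @Zorn_bigcup _ P.
  move=> F FP Ftot; split=> [x [X FX Xx]|a b [X FX Xa] [Y FY Yb] ab].
    by have [XB _] := FP _ FX; exact: XB.
  have [XY|YX] := Ftot _ _ FX FY.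
    by have [_] := FP _ FY; apply => //; exact: XY.
  by have [_] := FP _ FX; apply => //; exact: YX.
exists H => //; rewrite card_eq_le card_leT /=.
apply: contrapT => Hsmall.
pose N h := [set b | B b /\ c h b != i] `|` [set z | z <= h].
have JN h : H h -> J (N h).
  move=> /HB Bh; have [_ _ JU] := Ji; apply: JU; first exact: JB.
  by apply: Jb; exact: bounded_upper.
have PD : positive J (B `\` \bigcup_(h in H) N h).
  by apply: positive_setD => //; exact: complete_ideal_bigcup.
have [b [Bb nb]] := positive_nonempty _ _ _ Ji PD.
have hb h : H h -> h < b /\ c h b = i.
  move=> Hh; have : ~ N h b by move=> Nhb; apply: nb; exists h.
  move=> /not_orP[ch /negP]; rewrite -ltNge => hb; split=> //.
  by apply/eqP/negP => /negP chb; apply: ch.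
apply: (Hmax (b |` H)).
  split=> [x Hx|bH]; first by right.
  by have [] := hb b (bH _ (or_introl erefl)); rewrite ltxx.
split=> [x [->//|/HB]//|x y].
move=> [->|Hx] [->|Hy]; rewrite ?ltxx // => xy.
- by have [] := hb _ Hy => yb; move: (lt_trans yb xy); rewrite ltxx.
- by have [] := hb _ Hx.
- exact: Hi.
Qed.

(** If [B] is never split, each [a] has a colour [i a] equal to [c a b] for almost all [b] in [B].
    It is constant on a positive part of [B], which then contains a large homogeneous set. *)
Lemma small_splitting_strong_limit (disp : Order.disp_t) (K : orderType disp) :
  regular_cardinal K -> ~ countable [set: K] -> ~ weakly_compact K ->
  (forall a : K, card_lt [set X : set K | X `<=` [set x | x < a]] [set: K]) ->
  exists r : K -> set K, small_splitting r.
Proof.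
move=> regK uncK nwcK Klim; have [cardK _ _] := regK.
have [c cP] : exists c : K -> K -> bool, ~ exists H : set K, exists i : bool,
        H #= [set: K] /\ forall a b : K, H a -> H b -> a < b -> c a b = i.
  apply: contrapT => noc; apply: nwcK; split=> // c.
  by apply: contrapT => cH; apply: noc; exists c.
exists (fun b => [set a | c a b]) => J B JK PB; have [Ji Jc Jb] := JK.
apply: contrapT => nosplit.
have /choice[i iP] a : exists i : bool, J [set b | B b /\ c a b != i].
  apply: contrapT => noi; apply: nosplit; exists a; [exact: Klim | split].
    move=> JB; apply: noi; exists false; have [_ Jsub _] := Ji.
    by apply: Jsub JB => b /= []; case: (c a b).
  move=> JB; apply: noi; exists true; have [_ Jsub _] := Ji.
  by apply: Jsub JB => b /= []; case: (c a b).
have [j Pj] : exists j, positive J [set b | B b /\ i b = j].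
  apply: contrapT => noj; apply: PB; have [_ Jsub JU] := Ji.
  have Jj j : J [set b | B b /\ i b = j] by apply: contrapT => Pj; apply: noj; exists j.
  by apply: Jsub (JU _ _ (Jj true) (Jj false)) => b Bb; case ib: (i b); [left|right].
have [|H HK Hc] := homogeneous_set _ _ J c j _ regK JK Pj.
  move=> a [_ <-]; have [_ Jsub _] := Ji.
  by apply: Jsub (iP a) => b [[]].
by apply: cP; exists H, j.
Qed.

Lemma exists_small_splitting (disp : Order.disp_t) (K : orderType disp) :
  regular_cardinal K -> ~ countable [set: K] -> ~ weakly_compact K ->
  exists r : K -> set K, small_splitting r.
Proof.
move=> regK uncK nwcK.
have [/small_splitting_not_strong_limit|noa] := pselect (exists a : K,
  [set: K] #<= [set X : set K | X `<=` [set x | x < a]]); first exact.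
by apply: small_splitting_strong_limit => // a Ka; apply: noa; exists a.
Qed.

(** * Surjections and ladders *)

Lemma card_le_surj (T U : Type) (A : set T) (x0 : T) :
  A #<= [set: U] -> exists g : U -> T, forall x, A x -> exists y, g y = x.
Proof.
move=> /card_le_relP[R [Rfun RA]].
have /choice[g gP] y : exists x', forall x, R y x -> x' = x.
  have [[x Ryx]|noR] := pselect (exists x, R y x).
    by exists x => x'; exact: Rfun.
  by exists x0 => x Ryx; case: noR; exists x.
exists g => x /RA[y _ Ryx]; exists y; exact: gP.
Qed.

(** Where possible, all fibres of [f delta] are bounded below [delta]. For the least [delta] with
    infinitely many points of [S] below it, such fibres meet [S] in finite sets, so the image is
    infinite. *)
Lemma infinite_set_ladder (disp : Order.disp_t) (K : orderType disp) :
  regular_cardinal K -> ~ countable [set: K] ->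
  exists f : K -> K -> nat, forall S : set K, infinite_set S ->
    exists delta, infinite_set (f delta @` S).
Proof.
move=> regK uncK; have [[woK _] Kinf Kreg] := regK.
pose ladder delta (f : K -> nat) :=
  forall n, exists2 x, x < delta & forall y, y < delta -> f y = n -> y < x.
have /choice[f fP] delta : exists f, (exists g, ladder delta g) -> ladder delta f.
  have [[g gP]|nog] := pselect (exists g, ladder delta g); first by exists g.
  by exists (fun=> 0%N).
exists f => S Sinf.
(* A countable subset of [S] is bounded, by regularity and uncountability. *)
have [a aS] : exists a, infinite_set (S `&` [set x | x < a]).
  have [e einj eS] := infinite_set_seq _ _ Sinf.
  have [[a ea]|eunb] := pselect (bounded_subset (range e)).
    exists a; apply/infiniteP; apply: (@inj_on_card_le _ _ e) => [n _|n m _ _ /einj//].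
    by split; [exact: eS | apply: ea; exists n].
  by case: uncK; apply: card_le_trans (Kreg _ eunb) (card_image_le _ _).
have [delta Sdelta deltamin] := well_order_min _ _
  (fun a => infinite_set (S `&` [set x | x < a])) woK (ex_intro _ a aS).
have Sfin x : x < delta -> finite_set (S `&` [set y | y < x]).
  by move=> /deltamin/contrapT.
have /fP fl : exists g, ladder delta g.
  have [e einj eS] := infinite_set_seq _ _ Sdelta.
  have eunb y : y < delta -> exists n, y < e n.
    move=> yd; apply: contrapT => ney.
    have /infiniteP : [set: nat] #<= y |` (S `&` [set z | z < y]).
      apply: (@inj_on_card_le _ _ e) => [n _|n m _ _ /einj//].
      have [Sn _] := eS n; have [ny|yn|->] := ltgtP (e n) y; last by left.
        by right.
      by case: ney; exists n.
    by apply; rewrite finite_setU; split; [exact: finite_set1 | exact: Sfin].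
  have /choice[g gP] y : exists n, y < delta -> y < e n.
    have [/eunb[n yn]|yd] := pselect (y < delta); first by exists n.
    by exists 0%N => /yd.
  exists g => n; exists (e n); first by case: (eS n).
  by move=> y yd <-; exact: gP.
exists delta => imfin; apply: Sdelta.
apply: (sub_finite_set _ (bigcup_finite imfin
    (F := fun n => S `&` [set y | y < delta /\ f delta y = n]) _)).
  by move=> x [Sx xd]; exists (f delta x); [exists x | split].
move=> n _; have [x xd xP] := fl n.
by apply: sub_finite_set (Sfin _ xd) => y [Sy [yd fy]]; split=> //; exact: xP.
Qed.

Lemma finite_nat_bounded (A : set nat) : finite_set A ->
  exists N, forall n, A n -> (n < N)%N.
Proof.
move=> /finite_seqP[s ->]; exists (\max_(i <- s) i).+1 => n /= ns.
by rewrite ltnS; exact: leq_bigmax_seq.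
Qed.

(* [block_start d] cuts the naturals into blocks such that the block starting
   at [p] extends beyond [d p]; [block_label d] sends the [k]-th block to
   [logn 2 k], so that every label is used by infinitely many blocks. *)
Definition block_start (d : nat -> nat) (k : nat) : nat :=
  iter k (fun p => (maxn p (d p)).+1) 0%N.

Lemma block_start_mono (d : nat -> nat) (j k : nat) :
  (j <= k)%N -> (block_start d j <= block_start d k)%N.
Proof.
move=> /subnK<-; elim: (k - j)%N => //= n /leq_trans; apply.
by rewrite leqW // leq_maxl.
Qed.

Lemma leq_block_start (d : nat -> nat) (k : nat) : (k <= block_start d k)%N.
Proof.
by elim: k => //= k IH; rewrite ltnS (leq_trans IH) // leq_maxl.
Qed.

Lemma block_exists (d : nat -> nat) (m : nat) :
  exists k, (m < block_start d k.+1)%N.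
Proof. by exists m; exact: leq_block_start. Qed.

Definition block_label (d : nat -> nat) (m : nat) : nat :=
  logn 2 (ex_minn (block_exists d m)).

Lemma block_labelE (d : nat -> nat) (k m : nat) :
  (block_start d k <= m < block_start d k.+1)%N -> block_label d m = logn 2 k.
Proof.
move=> /andP[km mk]; rewrite /block_label; case: ex_minnP => j mj jmin.
congr logn; apply/eqP; rewrite eqn_leq (jmin _ mk) /= leqNgt.
apply/negP => jk; move: (leq_trans mj (block_start_mono d _ _ jk)).
by rewrite ltnNge km.
Qed.

Lemma dominating_block_label (D : set (nat -> nat)) (A : set nat) :
  dominating_family D -> infinite_set A ->
  exists2 d, D d & forall n, exists2 m, A m & block_label d m = n.
Proof.
move=> Ddom Ainf.
have /choice[f fP] n : exists m, A m /\ (n <= m)%N.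
  apply: contrapT => nom; apply: Ainf; apply: sub_finite_set (finite_II n) => m Am /=.
  by rewrite ltnNge; apply/negP => nm; apply: nom; exists m.
have [d Dd /finite_nat_bounded[N NP]] := Ddom f.
exists d => // n; pose k := (2 ^ n * N.*2.+1)%N; pose p := block_start d k.
have kN : (N <= k)%N.
  rewrite (leq_trans _ (leq_pmull _ _)) ?expn_gt0 //.
  by rewrite leqW // -addnn leq_addr.
have fd : (f p < d p)%N.
  apply: contrapT => /NP; apply/negP; rewrite -leqNgt.
  exact: leq_trans kN (leq_block_start _ _).
exists (f p); first by case: (fP p).
rewrite (block_labelE _ k).
  rewrite lognM ?expn_gt0 // pfactorK // lognE.
  by rewrite /= dvdn2 /= odd_double addn0.
by case: (fP p) => _ -> /=; rewrite ltnS (leq_trans (ltnW fd)) // leq_maxr.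
Qed.

Theorem theorem5p8 (disp : Order.disp_t) (K : orderType disp)
  (D : set (nat -> nat))
  (regK : regular_cardinal K)
  (uncountableK : ~ countable [set: K])
  (not_wcK : ~ weakly_compact K)
  (D_dominating : has_dominating_number D)
  (D_le_K : D #<= [set: K]) :
  onto_plus_omega (complete_ideals K).
Proof.
have [cardK Kinf _] := regK; have [woK _] := cardK.
have [Ddom _] := D_dominating.
have [k0 _] : [set: K] !=set0 by exact: infinite_setN0.
have [r rsplit] := exists_small_splitting _ _ regK uncountableK not_wcK.
have [f fP] := infinite_set_ladder _ _ regK uncountableK.
have [h hP] := card_le_surj _ _ _ id D_le_K.
have [e eP] := card_le_surj _ _ _ (k0, k0) (card_cardinalX2 _ _ cardK Kinf).
pose splitting eta b := xget k0 [set g | splits_at (r eta) (r b) g].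
pose colour eta delta z b := block_label (h z) (f delta (splitting eta b)).
exists (fun a b => colour (e a).1 (e (e a).2).1 (e (e a).2).2 b) => J JK B PB.
have [Ji _ Jb] := JK.
have [eta etainf] := infinite_positive_splits _ _ _ _ _ woK uncountableK rsplit JK PB.
have [delta deltainf] := fP _ etainf.
have [d Dd dP] := dominating_block_label _ _ Ddom deltainf.
have [z zE] := hP _ Dd.
have [q qE] := eP (delta, z) (conj I I).
have [a aE] := eP (eta, q) (conj I I).
exists a => n; rewrite aE /= qE /=.
have [_ [g Pg <-] gn] := dP n.
have Pg' := positive_setD _ _ _ _ Ji (Jb _ (bounded_upper _ _ a regK)) Pg.
apply: positive_sub Pg' => // b [[Bb rb] /negP]; rewrite -ltNge => ab; split=> //.
have -> : colour eta delta z b = block_label d (f delta (splitting eta b)).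
  by rewrite -zE.
suff -> : splitting eta b = g by [].
rewrite /splitting; case: xgetP => [g' _ rg'|/(_ g)//].
exact: splits_at_inj rg' rb.
Qed.
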